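(* Let $X$ be a nonempty set and $\tau$ a nonempty family of subsets of $X$ such that $(X,\tau)$ is $T_1$, and let $\beta\le\alpha$ be infinite ordinals. Then the following conditions are equivalent. (1) $(X,\tau)$ is $[\beta,\alpha]$-compact. (2) $(X,\tau)$ is $[\beta^{**},\alpha+\omega_1)$-compact. (3) $(X,\tau)$ is both $[\beta^{**},\beta^{**}]$-compact, and $[\gamma,\gamma]$-compact for every $\gamma$ such that $\beta\le\gamma\le\alpha$ and $\gamma=\gamma^*$.
   Context: For a nonempty set $X$, a nonempty family $\tau$ of subsets of $X$ (not necessarily a topology) and nonzero ordinals $\alpha,\beta$, $(X,\tau)$ is $[\beta,\alpha]$-compact if, whenever $(O_\delta)_{\delta\in\alpha}$ is a sequence of members of $\tau$ (repetitions allowed) with $\bigcup_{\delta\in\alpha}O_\delta=X$, there is $H\subseteq\alpha$ of order type $<\beta$ (in the induced order) with $\bigcup_{\delta\in H}O_\delta=X$. $(X,\tau)$ is $[\beta,\alpha)$-compact if it is $[\beta,\alpha']$-compact for every nonzero $\alpha'<\alpha$. $(X,\tau)$ is $T_1$ if for every $O\in\tau$ and every $x\in O$, $O\setminus\{x\}\in\tau$ (for a topology $\tau$ this is the usual $T_1$ axiom). For an ordinal $\beta$, $\beta^*$ denotes the smallest ordinal $\le\beta$ such that the interval $[\beta^*,\beta]=\{\delta\mid\beta^*\le\delta\le\beta\}$ is countable, i.e. $|[\beta^*,\beta]|\le\omega$. Moreover, $\beta^{**}=\beta^*$ if either $\operatorname{cf}\beta^*=\omega$ or $\beta=\beta^*+n$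 for some $n<\omega$, and $\beta^{**}=\beta^*+\omega$ otherwise. The operation $+$ is ordinal sum; the Axiom of Choice is assumed. *)

(* Defs.v *)
From HB Require Import structures.
From mathcomp Require Import all_boot all_order.
From mathcomp Require Import generic_quotient.
From mathcomp Require Import boolp wochoice classical_sets functions cardinality.

Set Implicit Arguments.
Unset Strict Implicit.
Unset Printing Implicit Defensive.

Import Order.TTheory.

Local Open Scope classical_set_scope.
Local Open Scope order_scope.
Local Open Scope quotient_scope.

(* The ordinals are the order types of well-ordered types: [Ord] is the       *)
(* quotient of [wotype] by isomorphism, ordered by embeddability as an        *)
(* initial segment. The ordinal [a], seen as a set of ordinals, is [seg a].   *)

Record wotype : Type := WOType {
  wo_sort :> Type;
  wo_le : rel wo_sort;
  wo_leP : well_order wo_le }.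

HB.instance Definition _ := gen_eqMixin wotype.
HB.instance Definition _ := gen_choiceMixin wotype.

Section WoTheory.
Variable A : wotype.
Implicit Types x y z : A.

Definition wo_lt x y := ~~ wo_le y x.

Lemma wo_min (P : set A) :
  (exists x, P x) -> exists2 x, P x & forall y, P y -> wo_le x y.
Proof.
move=> [x Px]; have [|z [[zP zmin] _]] := @wo_leP A [pred x | `[<P x>]].
  by exists x; apply/asboolP.
exists z; first exact/asboolP.
by move=> y Py; apply: zmin; apply/asboolP.
Qed.

Lemma wo_le_total x y : wo_le x y || wo_le y x.
Proof.
have [|z [->|->] zmin] := @wo_min [set t | t = x \/ t = y]; first by exists x; left.
- by rewrite zmin//; right.
- by rewrite (zmin x) ?orbT//; left.
Qed.

Lemma wo_lexx x : wo_le x x.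
Proof. by have := wo_le_total x x; rewrite orbb. Qed.

Lemma wo_le_anti x y : wo_le x y -> wo_le y x -> x = y.
Proof.
move=> xy yx; have [|z [_ zu]] := @wo_leP A [pred t | `[<t = x \/ t = y>]].
  by exists x; apply/asboolP; left.
have h t : t = x \/ t = y -> wo_le t x -> wo_le t y -> z = t.
  move=> txy tx ty; apply: zu; split; first exact/asboolP.
  by move=> u /asboolP[]->.
transitivity z; first by apply/esym/h => //; [left|exact: wo_lexx].
by apply: h => //; [right|exact: wo_lexx].
Qed.

Lemma wo_le_trans y x z : wo_le x y -> wo_le y z -> wo_le x z.
Proof.
move=> xy yz.
have [|m [->|[->|->]] mmin] := @wo_min [set t | t = x \/ t = y \/ t = z].
- by exists x; left.
- by apply: mmin; right; right.
- by rewrite (wo_le_anti xy)//; apply: mmin; left.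
- by rewrite -(wo_le_anti yz)//; apply: mmin; right; left.
Qed.

Lemma wo_ltW x y : wo_lt x y -> wo_le x y.
Proof. by move=> /negbTE yx; have := wo_le_total x y; rewrite yx orbF. Qed.

Lemma wo_ltxx x : ~~ wo_lt x x.
Proof. by rewrite negbK wo_lexx. Qed.

Lemma wo_lt_trans y x z : wo_lt x y -> wo_lt y z -> wo_lt x z.
Proof.
move=> xy yz; apply/negP => zx; move/negP: yz; apply.
exact: wo_le_trans zx (wo_ltW xy).
Qed.

Lemma wo_ltgt x y : [\/ wo_lt x y, x = y | wo_lt y x].
Proof.
rewrite /wo_lt; case xy: (wo_le x y); case yx: (wo_le y x).
- by apply: Or32; exact: wo_le_anti.
- by apply: Or31.
- by apply: Or33.
- by have := wo_le_total x y; rewrite xy yx.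
Qed.

Lemma wo_ind (P : A -> Prop) :
  (forall x, (forall y, wo_lt y x -> P y) -> P x) -> forall x, P x.
Proof.
move=> IH x; apply: contrapT => nPx.
have [|z nPz zmin] := @wo_min [set t | ~ P t]; first by exists x.
apply: nPz; apply: IH => y yz; apply: contrapT => /zmin.
by apply/negP.
Qed.

End WoTheory.

Definition wo_embed (A B : wotype) (f : A -> B) : Prop :=
  {mono f : x y / wo_le x y} /\
  (forall (x : A) (b : B), wo_le b (f x) -> exists y, f y = b).

Definition wo_iso (A B : wotype) : bool :=
  `[< exists2 f : A -> B, bijective f & {mono f : x y / wo_le x y} >].

Definition wo_emb (A B : wotype) : bool := `[< exists f : A -> B, wo_embed f >].

Lemma wo_iso_refl : reflexive wo_iso.
Proof. by move=> A; apply/asboolP; exists id => //; exists id. Qed.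

Lemma wo_iso_sym : symmetric wo_iso.
Proof.
suff h A B : wo_iso A B -> wo_iso B A.
  by move=> A B; apply/idP/idP; exact: h.
move=> /asboolP[f [g fg gf] fm]; apply/asboolP; exists g; first by exists f.
by move=> x y; rewrite -fm !gf.
Qed.

Lemma wo_iso_trans : transitive wo_iso.
Proof.
move=> B A C /asboolP[f fb fm] /asboolP[g gb gm]; apply/asboolP.
exists (g \o f); first exact: bij_comp.
by move=> x y /=; rewrite gm fm.
Qed.

Canonical wo_iso_equiv := EquivRel wo_iso wo_iso_refl wo_iso_sym wo_iso_trans.

Definition Ord : Type := {eq_quot wo_iso}.
HB.instance Definition _ := Choice.on Ord.
HB.instance Definition _ := EqQuotient.on Ord.

Definition otype (A : wotype) : Ord := \pi_Ord A.

Lemma otype_repr (a : Ord) : otype (repr a) = a.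
Proof. exact: reprK. Qed.

Lemma repr_otype (A : wotype) : wo_iso (repr (otype A)) A.
Proof. by apply/eqmodP; rewrite reprK. Qed.

Lemma otype_eq (A B : wotype) : otype A = otype B <-> wo_iso A B.
Proof. by split => [/eqmodP|AB]//; apply/eqmodP. Qed.

Lemma wo_embed_inj (A B : wotype) (f : A -> B) : wo_embed f -> injective f.
Proof.
move=> [fm _] x y fxy; apply: wo_le_anti; rewrite -fm fxy; exact: wo_lexx.
Qed.

Lemma wo_embed_comp (A B C : wotype) (f : A -> B) (g : B -> C) :
  wo_embed f -> wo_embed g -> wo_embed (g \o f).
Proof.
move=> [fm fi] [gm gi]; split => [x y /=|x c /= cx]; first by rewrite gm fm.
have [b bc] := gi _ _ cx; subst c; rewrite gm in cx.
by have [y yb] := fi _ _ cx; exists y; rewrite yb.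
Qed.

Lemma wo_embed_id (A : wotype) (f : A -> A) : wo_embed f -> f =1 id.
Proof.
move=> fe; have [fm fi] := fe; apply: wo_ind => x IH.
case: (wo_ltgt (f x) x) => // [lt|lt].
  have /(wo_embed_inj fe) E := IH _ lt.
  by move: lt; rewrite E (negbTE (wo_ltxx _)).
have [y yx] := fi _ _ (wo_ltW lt).
have yltx : wo_lt y x by rewrite /wo_lt -fm yx.
have := IH _ yltx; rewrite yx => E.
by move: yltx; rewrite {1}E (negbTE (wo_ltxx _)).
Qed.

Lemma wo_iso_emb (A B : wotype) : wo_iso A B -> wo_emb A B.
Proof.
move=> /asboolP[f [g fg gf] fm]; apply/asboolP; exists f; split => // x b _.
by exists (g b).
Qed.

Lemma wo_emb_anti (A B : wotype) : wo_emb A B -> wo_emb B A -> wo_iso A B.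
Proof.
move=> /asboolP[f fe] /asboolP[g ge]; apply/asboolP; exists f; last by case: fe.
exists g; first exact: (wo_embed_id (wo_embed_comp fe ge)).
exact: (wo_embed_id (wo_embed_comp ge fe)).
Qed.

Lemma wo_embed_surj (A B : wotype) (f : A -> B) :
  wo_embed f -> (forall y, exists x, f x = y) -> wo_iso A B.
Proof.
move=> fe /choice[g fg]; apply/asboolP; exists f; last by case: fe.
by exists g => // x; apply: (wo_embed_inj fe).
Qed.

Lemma wo_emb_trans : transitive wo_emb.
Proof.
move=> B A C /asboolP[f fe] /asboolP[g ge]; apply/asboolP.
by exists (g \o f); exact: wo_embed_comp.
Qed.

Section Comparison.
Variables A B : wotype.

Inductive wo_sim : A -> B -> Prop := WoSim (x : A) (y : B) of
  (forall x', wo_lt x' x -> exists2 y', wo_lt y' y & wo_sim x' y') &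
  (forall y', wo_lt y' y -> exists2 x', wo_lt x' x & wo_sim x' y') :
  wo_sim x y.

Lemma wo_siml x y x' : wo_sim x y -> wo_lt x' x ->
  exists2 y', wo_lt y' y & wo_sim x' y'.
Proof. by case=> {}x {}y h _; exact: h. Qed.

Lemma wo_simr x y y' : wo_sim x y -> wo_lt y' y ->
  exists2 x', wo_lt x' x & wo_sim x' y'.
Proof. by case=> {}x {}y _; exact. Qed.

Lemma wo_sim_fun x y y' : wo_sim x y -> wo_sim x y' -> y = y'.
Proof.
elim/wo_ind: x y y' => x IH.
have h y y' : wo_sim x y -> wo_sim x y' -> ~~ wo_lt y y'.
  move=> xy xy'; apply/negP => /(wo_simr xy')[x1 x1x x1y].
  have [y2 y2y x1y2] := wo_siml xy x1x.
  by move: y2y; rewrite (IH _ x1x _ _ x1y2 x1y) (negbTE (wo_ltxx _)).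
move=> y y' xy xy'; case: (wo_ltgt y y') => // lt.
  by have := h _ _ xy xy'; rewrite lt.
by have := h _ _ xy' xy; rewrite lt.
Qed.

Lemma wo_sim_inj x x' y : wo_sim x y -> wo_sim x' y -> x = x'.
Proof.
elim/wo_ind: y x x' => y IH.
have h x x' : wo_sim x y -> wo_sim x' y -> ~~ wo_lt x x'.
  move=> xy x'y; apply/negP => /(wo_siml x'y)[y1 y1y xy1].
  have [x2 x2x x2y1] := wo_simr xy y1y.
  by move: x2x; rewrite (IH _ y1y _ _ x2y1 xy1) (negbTE (wo_ltxx _)).
move=> x x' xy x'y; case: (wo_ltgt x x') => // lt.
  by have := h _ _ xy x'y; rewrite lt.
by have := h _ _ x'y xy; rewrite lt.
Qed.

Lemma wo_sim_lt x x' y y' : wo_sim x y -> wo_sim x' y' ->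
  wo_lt x x' = wo_lt y y'.
Proof.
move=> xy xy'; apply/idP/idP => [xx'|yy'].
  by have [y1 ? /(wo_sim_fun xy) ->] := wo_siml xy' xx'.
by have [x1 ? /(wo_sim_inj xy) ->] := wo_simr xy' yy'.
Qed.

Lemma wo_sim_full :
  (forall x, exists y, wo_sim x y) \/ (forall y, exists x, wo_sim x y).
Proof.
apply: contrapT => /not_orP[/existsNP[x0 nx0] /existsNP[y0 ny0]].
have [|x nx xmin] := @wo_min A [set x | ~ exists y, wo_sim x y].
  by exists x0.
have [|y ny ymin] := @wo_min B [set y | ~ exists x, wo_sim x y].
  by exists y0.
apply: (nx); exists y; constructor => [x' x'x|y' y'y].
  have [y' xy'] : exists y', wo_sim x' y'.
    by apply: contrapT => /xmin; exact/negP.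
  exists y' => //; case: (wo_ltgt y' y) => // [E|yy'].
    by case: ny; exists x'; rewrite -E.
  by have [x'' _ ?] := wo_simr xy' yy'; case: ny; exists x''.
have [x' xy'] : exists x', wo_sim x' y'.
  by apply: contrapT => /ymin; exact/negP.
exists x' => //; case: (wo_ltgt x' x) => // [E|xx'].
  by case: nx; exists y'; rewrite -E.
by have [y'' _ ?] := wo_siml xy' xx'; case: nx; exists y''.
Qed.

End Comparison.

Lemma wo_sim_sym (A B : wotype) (x : A) (y : B) : wo_sim x y -> wo_sim y x.
Proof.
elim/wo_ind: x y => x IH y xy; constructor => [y' y'y|x' x'x].
  by have [x' x'x /IH] := wo_simr xy y'y; exists x' => //; auto.
by have [y' y'y /IH] := wo_siml xy x'x; exists y' => //; auto.
Qed.

Lemma wo_sim_emb (A B : wotype) :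
  (forall x : A, exists y : B, wo_sim x y) -> wo_emb A B.
Proof.
move=> /choice[f fP]; apply/asboolP; exists f; split => [x y|x b].
  by apply: negb_inj; rewrite -!/(wo_lt _ _) -(wo_sim_lt (fP y) (fP x)).
case: (wo_ltgt b (f x)) => [lt _|-> _|]; last by rewrite /wo_lt => /negbTE->.
  have [x' _ x'b] := wo_simr (fP x) lt.
  by exists x'; exact: wo_sim_fun (fP x') x'b.
by exists x.
Qed.

Lemma wo_emb_total : total wo_emb.
Proof.
move=> A B; apply/orP; case: (wo_sim_full A B) => h.
  by left; exact: wo_sim_emb.
by right; apply: wo_sim_emb => y; have [x /wo_sim_sym] := h y; exists x.
Qed.

Definition ord_le (a b : Ord) : bool := wo_emb (repr a) (repr b).

Lemma ord_le_refl : reflexive ord_le.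
Proof. by move=> a; apply: wo_iso_emb; exact: wo_iso_refl. Qed.

Lemma ord_le_anti : antisymmetric ord_le.
Proof.
move=> a b /andP[ab ba]; rewrite -[a]otype_repr -[b]otype_repr.
by apply/otype_eq; exact: wo_emb_anti.
Qed.

Lemma ord_le_trans : transitive ord_le.
Proof. by move=> b a c; exact: wo_emb_trans. Qed.

Lemma ord_le_total : total ord_le.
Proof. by move=> a b; exact: wo_emb_total. Qed.

Fact ord_display : Order.disp_t. Proof. exact: Order.Disp tt tt. Qed.

HB.instance Definition _ := Order.Le_isPOrder.Build ord_display Ord
  ord_le_refl ord_le_anti ord_le_trans.
HB.instance Definition _ := Order.POrder_isTotal.Build ord_display Ord
  ord_le_total.

Lemma otype_le (A B : wotype) : (otype A <= otype B) = wo_emb A B.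
Proof.
have iA := repr_otype A; have iB := repr_otype B.
have iA' : wo_iso A (repr (otype A)) by rewrite wo_iso_sym.
have iB' : wo_iso B (repr (otype B)) by rewrite wo_iso_sym.
apply/idP/idP => h.
  exact: wo_emb_trans (wo_iso_emb iA') (wo_emb_trans h (wo_iso_emb iB)).
exact: wo_emb_trans (wo_iso_emb iA) (wo_emb_trans h (wo_iso_emb iB')).
Qed.

Definition seg (a : Ord) : set Ord := [set d | d < a].

(* The initial segments of a well-ordered type: [oseg] is an isomorphism from *)
(* [A] onto [seg (otype A)], so that [seg a] has order type [a].              *)

Section InitialSegment.
Variable A : wotype.

Lemma wo_restr_wo (P : pred A) :
  well_order (fun x y : {x | P x} => wo_le (sval x) (sval y)).
Proof.
apply: antisymmetric_well_order => [x y /andP[xy yx]|S [x Sx]].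
  by apply: val_inj; exact: wo_le_anti.
have [|_ [z Sz <-] zmin] := @wo_min A [set z | exists2 t, t \in S & sval t = z].
  by exists (sval x), x.
by exists z; split => // t St; apply: zmin; exists t.
Qed.

Definition wo_restr (P : pred A) : wotype := WOType (@wo_restr_wo P).

Definition oseg (x : A) : Ord := otype (wo_restr (fun y => wo_lt y x)).

Lemma oseg_lt x : oseg x < otype A.
Proof.
rewrite ltNge otype_le; apply/negP => /asboolP[f fe].
pose g (y : A) := sval (f y).
have ge : wo_embed g.
  split=> [y z|y z zy]; first exact: (proj1 fe).
  have zx : wo_lt z x.
    rewrite /wo_lt; apply/negP => xz; have := svalP (f y).
    by move/negP; apply; exact: wo_le_trans zy.
  have [t tz] := proj2 fe y (exist (fun y => wo_lt y x) z zx) zy.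
  by exists t; rewrite /g tz.
have := svalP (f x); rewrite -/(g x) (wo_embed_id ge).
by rewrite (negbTE (wo_ltxx _)).
Qed.

Lemma oseg_le : {mono oseg : x y / wo_le x y >-> x <= y}.
Proof.
have h x y : wo_le x y -> oseg x <= oseg y.
  move=> xy; rewrite otype_le; apply/asboolP.
  have xyP (z : A) : wo_lt z x -> wo_lt z y.
    by move=> zx; apply/negP => yz; move/negP: zx; apply; exact: wo_le_trans yz.
  exists (fun z : wo_restr (fun y => wo_lt y x) => exist _ (sval z) (xyP _ (svalP z))).
  split=> // z [b bP] /= bz.
  have bx : wo_lt b x.
    apply/negP => xb; have := svalP z; apply/negP; rewrite negbK.
    exact: wo_le_trans bz.
  by exists (exist _ b bx); exact: val_inj.
move=> x y; apply/idP/idP => [|/h//].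
case: (wo_ltgt x y) => [/wo_ltW//|-> _|yx]; first exact: wo_lexx.
rewrite otype_le => /asboolP[f fe].
pose B := wo_restr (fun z => wo_lt z x); pose y' : B := exist _ y yx.
pose g (z : B) : B := exist _ (sval (f z)) (wo_lt_trans (svalP (f z)) yx).
have ge : wo_embed g.
  split=> [z t|z [b bx] /= bz]; first exact: (proj1 fe).
  have by_ : wo_lt b y.
    apply/negP => yb; have := svalP (f z); apply/negP; rewrite negbK.
    exact: wo_le_trans bz.
  have [t tb] := proj2 fe z (exist (fun z => wo_lt z y) b by_) bz.
  by exists t; apply: val_inj; rewrite /g /= tb.
have := svalP (f y'); rewrite -[sval (f y')]/(sval (g y')) (wo_embed_id ge).
by rewrite (negbTE (wo_ltxx _)).
Qed.

Lemma oseg_surj (a : Ord) : a < otype A -> exists x, oseg x = a.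
Proof.
rewrite -(otype_repr a) ltNge otype_le => /negP aA.
have := wo_emb_total (repr a) A; rewrite (negbTE (introN idP aA)) orbF.
move=> /asboolP[f fe].
have [|x nx xmin] := @wo_min A [set x | ~ exists y, f y = x].
  apply: contrapT => /forallNP /= h; apply: aA; apply: wo_iso_emb.
  rewrite wo_iso_sym; apply: (wo_embed_surj fe) => x.
  exact: contrapT.
have fx y : wo_lt (f y) x by apply/negP => /(proj2 fe y).
pose g (y : repr a) : wo_restr (fun z => wo_lt z x) := exist _ (f y) (fx y).
exists x; apply/esym/otype_eq; apply: (@wo_embed_surj _ _ g) => [|[y yx]].
  split=> [y z|y [z zx] /= zy]; first exact: (proj1 fe).
  by have [t tz] := proj2 fe _ _ zy; exists t; exact: val_inj.
have [t ty] : exists t, f t = y by apply: contrapT => /xmin; exact/negP.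
by exists t; exact: val_inj.
Qed.

End InitialSegment.

Lemma ord_min (P : set Ord) : P !=set0 -> exists2 a, P a & lbound P a.
Proof.
move=> [b Pb]; apply: contrapT => nmin.
have [c Pc cb] : exists2 c, P c & c < b.
  apply: contrapT => nc; apply: nmin; exists b => // c Pc.
  by rewrite leNgt; apply/negP => cb; apply: nc; exists c.
move: cb; rewrite -(otype_repr b) => /oseg_surj[x xc].
have [|y Py ymin] := @wo_min (repr b) [set y | P (oseg y)].
  by exists x; rewrite /= xc.
apply: nmin; exists (oseg y) => // d Pd.
rewrite leNgt; apply/negP => dy.
have /oseg_surj[z zd] := lt_trans dy (oseg_lt y).
by move: dy; rewrite -zd ltNge oseg_le ymin//= zd.
Qed.

Lemma void_wo : well_order (fun _ _ : void => true).
Proof. by move=> S [[]]. Qed.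

Definition ozero : Ord := otype (WOType void_wo).

Lemma ozero_le (a : Ord) : ozero <= a.
Proof.
rewrite -(otype_repr a) otype_le; apply/asboolP.
by exists (of_void _); split=> -[].
Qed.

(* If [P] is empty, [least P] is the junk value 0.                            *)
Definition least (P : set Ord) : Ord := xget ozero [set a | P a /\ lbound P a].

Lemma leastP (P : set Ord) : P !=set0 -> P (least P) /\ lbound P (least P).
Proof.
move=> /ord_min[a Pa aP]; rewrite /least.
by case: xgetP => [_ -> //|/(_ a)[]].
Qed.

Lemma nat_wo : well_order (fun m n : nat => (m <= n)%N).
Proof.
apply: antisymmetric_well_order => [|S [n Sn]]; first exact: anti_leq.
have exS : exists n, n \in S by exists n.
by exists (ex_minn exS); case: ex_minnP.
Qed.

Definition omega : Ord := otype (WOType nat_wo).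

Definition omega1 : Ord := least [set a | ~ countable (seg a)].

Lemma uncountable_ord : exists a : Ord, ~ countable (seg a).
Proof.
have [R Rwo] : exists R : rel (nat -> bool), well_order R.
  have [R Rwo] := @well_ordering_principle {classic nat -> bool}.
  by exists R.
exists (otype (WOType Rwo)) => /countable_injP[f finj].
pose h (S : nat -> bool) : nat := f (@oseg (WOType Rwo) S).
have hinj : injective h.
  move=> S T /finj E; apply: (@wo_le_anti (WOType Rwo)); rewrite -oseg_le E//;
    by apply/mem_set; exact: oseg_lt.
pose D (n : nat) : bool := `[< exists2 S, h S = n & ~~ S n >].
have nD : ~~ D (h D).
  by apply/negP => /[dup] DD /asboolP[S /hinj ->]; rewrite DD.
by move/negP: (nD); apply; apply/asboolP; exists D.
Qed.

Lemma omega1P :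
  ~ countable (seg omega1) /\ (forall a, a < omega1 -> countable (seg a)).
Proof.
have [o1 o1min] := leastP uncountable_ord; split => // a; rewrite ltNge => ao.
by apply: contrapT => na; move/negP: ao; apply; exact: o1min.
Qed.

Section Sum.
Variables A B : wotype.

Definition wo_sum_le (x y : A + B) : bool :=
  match x, y with
  | inl a, inl a' => wo_le a a'
  | inl _, inr _ => true
  | inr _, inl _ => false
  | inr b, inr b' => wo_le b b'
  end.

Lemma wo_sum_wo : well_order wo_sum_le.
Proof.
apply: antisymmetric_well_order => [[a|b] [a'|b']//= /andP[? ?]|S [x Sx]].
- by congr inl; exact: wo_le_anti.
- by congr inr; exact: wo_le_anti.
have [[a Sa]|nA] := pselect (exists a, inl a \in S).
  have [|m Sm mmin] := @wo_min A [set a | inl a \in S]; first by exists a.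
  by exists (inl m); split => // -[a'|//]; exact: mmin.
have [|m Sm mmin] := @wo_min B [set b | inr b \in S].
  by case: x Sx => [a Sa|b Sb]; [case: nA; exists a|exists b].
exists (inr m); split => // -[a Sa|b]; last exact: mmin.
by case: nA; exists a.
Qed.

Definition wo_sum : wotype := WOType wo_sum_wo.

End Sum.

Definition ord_add (a b : Ord) : Ord := otype (wo_sum (repr a) (repr b)).

Declare Scope ordinal_scope.
Delimit Scope ordinal_scope with Ord.
Bind Scope ordinal_scope with Ord.
Notation "a + b" := (ord_add a b) : ordinal_scope.
Local Open Scope ordinal_scope.

Definition has_otype (H : set Ord) (c : Ord) : Prop :=
  exists f : Ord -> Ord,
    (forall d e, seg c d -> seg c e -> (f d <= f e) = (d <= e)) /\
    f @` seg c = H.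

(* The cofinality of [a]: [C] is cofinal in [a] when no element of [a] lies   *)
(* strictly above [C], so that cf 0 = 0 and cf (a + 1) = 1.                   *)
Definition cf (a : Ord) : Ord :=
  least [set c | exists C : set Ord, [/\ C `<=` seg a,
    (forall d, d < a -> exists2 e, C e & d <= e) & has_otype C c]].

Lemma cfP (a : Ord) : exists C : set Ord, [/\ C `<=` seg a,
  (forall d, d < a -> exists2 e, C e & d <= e) & has_otype C (cf a)].
Proof.
have [|//] := @leastP [set c | exists C : set Ord, [/\ C `<=` seg a,
  (forall d, d < a -> exists2 e, C e & d <= e) & has_otype C c]].
exists a, (seg a); split => // [d da|]; first by exists d.
by exists id; split=> //; rewrite image_id.
Qed.

Definition star (b : Ord) : Ord :=
  least [set c | c <= b /\ countable [set d | c <= d <= b]].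

Lemma starP (b : Ord) :
  [/\ star b <= b, countable [set d | star b <= d <= b] &
    forall c, c <= b -> countable [set d | c <= d <= b] -> star b <= c].
Proof.
have [|[sb sc] smin] := @leastP [set c | c <= b /\ countable [set d | c <= d <= b]].
  exists b; split => //; apply: (@sub_countable _ _ _ [set b]) => //.
  by apply: subset_card_le => d /= bd; apply/eqP; rewrite eq_le andbC.
by split=> // c cb cc; exact: smin.
Qed.

Definition star2 (b : Ord) : Ord :=
  if `[< cf (star b) = omega \/ exists2 n, n < omega & b = star b + n >]
  then star b else star b + omega.

Section Compactness.
Variables (X : Type) (tau : set (set X)).

(* [compact_cc b a] is [b, a]-compactness and [compact_co b a] is             *)
(* [b, a)-compactness, where b and a are meant to be nonzero. A sequence of   *)
(* length a is a total function on ordinals used only on [seg a].             *)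
Definition compact_cc (b a : Ord) : Prop :=
  forall O : Ord -> set X,
    (forall d, d < a -> tau (O d)) ->
    \bigcup_(d in seg a) O d = setT ->
    exists H : set Ord, [/\ H `<=` seg a,
      (exists2 c, c < b & has_otype H c) &
      \bigcup_(d in H) O d = setT].

Definition compact_co (b a : Ord) : Prop :=
  forall a', ozero < a' -> a' < a -> compact_cc b a'.

Definition T1_family : Prop :=
  forall (O : set X) (x : X), tau O -> O x -> tau (O `\ x).

End Compactness.

(* Main.v *)
Require Import Defs.
From HB Require Import structures.
From mathcomp Require Import all_boot all_order.
From mathcomp Require Import boolp classical_sets functions cardinality.

(** Write b for [star beta]. Two facts about order types drive everything.

    - Call h countably close to g if [h, g) is countable. If no h < g is
      countably close to g (these g are exactly the fixed points of [star]),
      then a set of ordinals of type less than g keeps type less than g after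
      countably many ordinals are added to it ([small_countableU]). Countable
      sets of indices can then be moved anywhere in a rearrangement.
    - Adding finitely many elements to a subset of b gives type less than
      b + omega ([small_finite]).

    From (3) to (2). It suffices to shorten covers. Let z be the length of a
    cover, z < alpha + omega1, and put g = [star z]. If b is not countably
    close to z, then beta <= g <= alpha, so the space is [g, g]-compact. The countable
    part of the cover beyond g can be absorbed below omega, which turns the cover
    into one of length g; the resulting subcover has type less than g in the old
    order too ([compact_absorb]), and induction on z applies. Once b is countably
    close to z, the same rearrangement into b, or into b + omega if that is
    [star2 beta] ([compact_absorb_omega]), gives a subcover of type less than
    [star2 beta].

    From (1) to (3), only [star2 beta, star2 beta]-compactness needs an argument,
    and this is where T1 enters. In a cover of length [star2 beta] without a
    shorter subcover, call an index e essential when its member has a point x e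
    that lies in no earlier member. Choose a set E of essential indices, equinumerous with
    the interval [b, beta), such that each member contains only finitely many of
    the points x e with e in E. By T1 these points can be deleted wherever they
    are superfluous, so that x e lies in the member of index e alone and every
    subcover must use all of E. Moving E behind b produces a cover of length at
    most beta; a subcover of type less than beta contains the whole end segment
    [b, beta), so its part before b has type less than b, and adding the countable
    set E back in the original order does no harm ([compact_essential]). The three
    clauses in the definition of [star2] are exactly the three ways to find E
    ([compact_star2]). *)

Set Implicit Arguments.
Unset Strict Implicit.
Unset Printing Implicit Defensive.

Import Order.TTheory.

Local Open Scope card_scope.
Local Open Scope order_scope.
Local Open Scope classical_set_scope.

HB.instance Definition _ := isPointed.Build Ord ozero.

Lemma ord_ind (P : Ord -> Prop) :
  (forall a, (forall b, b < a -> P b) -> P a) -> forall a, P a.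
Proof.
move=> IH a; apply: contrapT => nPa.
have [|b nPb bmin] := @ord_min [set b | ~ P b]; first by exists a.
apply: nPb; apply: IH => c cb; apply: contrapT => /bmin.
by rewrite leNgt cb.
Qed.

Lemma ord_gt0 (a b : Ord) : b < a -> ozero < a.
Proof. exact/le_lt_trans/ozero_le. Qed.

(** * Countable and finite sets *)

Lemma countableU T (A B : set T) : countable A -> countable B -> countable (A `|` B).
Proof.
move=> cA cB; rewrite (_ : A `|` B = \bigcup_(i in [set: bool]) if i then A else B).
  by apply: bigcup_countable => [|[]//]; exact: countableP.
by apply/seteqP; split=> [x []h|x [[] _ h]]; [exists true|exists false|left|right].
Qed.

Lemma subset_countable T (A B : set T) : A `<=` B -> countable B -> countable A.
Proof. by move=> AB; apply/sub_countable/subset_card_le. Qed.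

Lemma inj_countable T U (f : T -> U) (A : set T) (B : set U) :
  {in A &, injective f} -> (forall x, A x -> B (f x)) -> countable B -> countable A.
Proof.
move=> finj fAB; apply: sub_countable; rewrite -(card_le_eql (inj_card_eq finj)).
by apply: subset_card_le => _ [x Ax <-]; exact: fAB.
Qed.

Lemma inj_finite T U (f : T -> U) (A : set T) (B : set U) :
  {in A &, injective f} -> (forall x, A x -> B (f x)) -> finite_set B -> finite_set A.
Proof.
move=> finj fAB; apply: card_le_finite; rewrite -(card_le_eql (inj_card_eq finj)).
by apply: subset_card_le => _ [x Ax <-]; exact: fAB.
Qed.

Lemma card_le_inj T (U : pointedType) (A : set T) (B : set U) : A #<= B ->
  exists f : T -> U, {in A &, injective f} /\ (forall x, A x -> B (f x)).
Proof.
move=> /pcard_leP/unsquash f; exists f; split; first exact: inj.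
by move=> x Ax; apply: funS.
Qed.

Lemma card_eq_inj T (U : pointedType) (A : set T) (B : set U) : A #= B ->
  exists f : T -> U, {in A &, injective f} /\ f @` A = B.
Proof.
move=> /pcard_eqP/unsquash f; exists f; split; first exact: inj.
exact: image_eq.
Qed.

(** * Order types of sets of ordinals *)

Definition strict_on (S : set Ord) (f : Ord -> Ord) : Prop :=
  forall x y, S x -> S y -> x < y -> f x < f y.

(** [small b S] means that S has order type less than b ([smallP]). Witnessing
    this by a strictly increasing map into some c < b, not necessarily onto,
    spares the computation of exact order types. *)
Definition small (b : Ord) (S : set Ord) : Prop :=
  exists c f, [/\ c < b, strict_on S f & forall x, S x -> f x < c].

Lemma strict_on_le S f x y : strict_on S f -> S x -> S y ->
  (f x <= f y) = (x <= y).
Proof.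
move=> fS Sx Sy; apply/idP/idP.
  by rewrite leNgt (leNgt x); apply: contra; exact: fS.
by rewrite le_eqVlt => /predU1P[->//|/(fS _ _ Sx Sy)/ltW].
Qed.

Lemma strict_on_lt S f x y : strict_on S f -> S x -> S y ->
  (f x < f y) = (x < y).
Proof. by move=> fS Sx Sy; rewrite !ltNge (strict_on_le fS). Qed.

Lemma strict_on_inj S f : strict_on S f -> {in S &, injective f}.
Proof.
move=> fS x y /set_mem Sx /set_mem Sy fxy.
by apply/le_anti; rewrite -(strict_on_le fS Sx Sy) -(strict_on_le fS Sy Sx) fxy lexx.
Qed.

Lemma strict_on_sub S T f : S `<=` T -> strict_on T f -> strict_on S f.
Proof. by move=> ST fT x y /ST Tx /ST Ty; exact: fT. Qed.

(** On an interval [a, b) a strictly increasing map that does not lower the first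
    element lowers none: the least counterexample d would give the smaller
    counterexample f d. *)
Lemma strict_on_ge a b f : strict_on [set d | a <= d < b] f -> (a < b -> a <= f a) ->
  forall d, a <= d < b -> d <= f d.
Proof.
move=> fS fa; elim/ord_ind => d IH /[dup] /= abd /andP[].
rewrite le_eqVlt => /predU1P[<- //|ad db]; rewrite leNgt; apply/negP => fdd.
have [afd|fda] := leP a (f d).
  have abfd : a <= f d < b by rewrite afd (lt_trans fdd).
  have := IH _ fdd abfd; apply/negP; rewrite -ltNge; exact: fS.
have ab := lt_trans ad db.
have := le_lt_trans (fa ab) (fS a d _ abd ad).
by rewrite /= lexx ab => /(_ isT)/(lt_trans fda); rewrite ltxx.
Qed.

Lemma strict_on_seg_ge b f : strict_on (seg b) f -> forall d, d < b -> d <= f d.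
Proof.
move=> fS d db; apply: (@strict_on_ge ozero b f) => [x y /andP[_ ?] /andP[_ ?]||].
- exact: fS.
- by move=> _; exact: ozero_le.
- by rewrite ozero_le.
Qed.

Lemma has_otypeE H c : has_otype H c <-> exists f, strict_on (seg c) f /\ f @` seg c = H.
Proof.
split=> -[f [fS fH]]; exists f; split=> // d e dc ec; last exact: strict_on_le fS _ _.
by rewrite !ltNge fS.
Qed.

(** The order type is realized by the elements of c that are values of f, viewed
    as a well-ordered subtype of a representative of c. *)
Lemma small_otype S f c : strict_on S f -> (forall x, S x -> f x < c) ->
  exists2 c', c' <= c & has_otype S c'.
Proof.
move=> fS fc.
pose P (y : repr c) : bool := `[< exists2 s, S s & f s = oseg y >].
pose w := wo_restr P.
have wP (z : w) : exists s, S s /\ f s = oseg (sval z).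
  by have /asboolP[s Ss E] := svalP z; exists s.
have wS s : S s -> exists z : w, oseg (sval z) = f s.
  move=> Ss; have := fc _ Ss; rewrite -{1}(otype_repr c) => /oseg_surj[y ys].
  have Py : P y by apply/asboolP; exists s.
  by exists (exist _ y Py).
have [g gP] := choice wP.
have gle (z z' : w) : (g z <= g z') = wo_le z z'.
  have [Sz fz] := gP z; have [Sz' fz'] := gP z'.
  by rewrite -(strict_on_le fS)// fz fz' oseg_le.
have [r rP] : exists r : Ord -> Ord, forall d z, oseg z = d -> r d = g z.
  suff /choice[r rP] : forall d, exists e, forall z : w, oseg z = d -> e = g z.
    by exists r.
  move=> d; have [[z zd]|nz] := pselect (exists z : w, oseg z = d).
    exists (g z) => z' z'd; congr g; apply: wo_le_anti; rewrite -oseg_le zd z'd//.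
  by exists d => z zd; case: nz; exists z.
have rstrict : strict_on (seg (otype w)) r.
  move=> _ _ /oseg_surj[x <-] /oseg_surj[y <-].
  by rewrite !(rP _ _ erefl) ltNge oseg_le ltNge gle.
have rim : r @` seg (otype w) = S.
  apply/seteqP; split=> [_ [d /oseg_surj[z <-] <-]|s Ss].
    by rewrite (rP _ _ erefl); have [] := gP z.
  have [z zs] := wS _ Ss; exists (oseg z); first exact: oseg_lt.
  rewrite (rP _ _ erefl); have [Sz fz] := gP z.
  by apply: (strict_on_inj fS); rewrite ?inE// fz.
exists (otype w); last by apply/has_otypeE; exists r.
rewrite leNgt; apply/negP => cw.
have rS d : d < otype w -> S (r d) by move=> dw; rewrite -rim; exists d.
have /strict_on_seg_ge/(_ c cw) : strict_on (seg (otype w)) (f \o r).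
  by move=> x y xw yw xy /=; apply: fS; [exact: rS|exact: rS|exact: rstrict].
by rewrite leNgt /= fc//; exact: rS.
Qed.

Lemma has_otype_small S c b : has_otype S c -> c < b -> small b S.
Proof.
move=> /has_otypeE[f [fS fim]] cb.
have [g gP] : exists g : Ord -> Ord, forall s, S s -> g s < c /\ f (g s) = s.
  suff /choice[g gP] : forall s, exists d, S s -> d < c /\ f d = s by exists g.
  move=> s; have [Ss|nS] := pselect (S s); last by exists s.
  by move: (Ss); rewrite -{1}fim => -[d dc ds]; exists d.
exists c, g; split=> // [x y Sx Sy|x /gP[]//].
have [gx fgx] := gP _ Sx; have [gy fgy] := gP _ Sy.
by rewrite -(strict_on_lt fS gx gy) fgx fgy.
Qed.

Lemma smallP b S : small b S <-> exists2 c, c < b & has_otype S c.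
Proof.
split=> [[c [f [cb fS fc]]]|[c cb Sc]]; last exact: has_otype_small Sc cb.
by have [c' c'c Sc'] := small_otype fS fc; exists c' => //; exact: le_lt_trans cb.
Qed.

Lemma small_sub b S T : S `<=` T -> small b T -> small b S.
Proof.
move=> ST [c [f [cb fS fc]]]; exists c, f; split=> // [|x /ST]; last exact: fc.
exact: strict_on_sub ST fS.
Qed.

Lemma small_leW b b' S : b <= b' -> small b S -> small b' S.
Proof. by move=> bb' [c [f [cb fS fc]]]; exists c, f; split=> //; exact: lt_le_trans bb'. Qed.

Lemma small_image b S f : strict_on S f -> small b S -> small b (f @` S).
Proof.
move=> fS /smallP[c cb /has_otypeE[g [gS gim]]]; apply/smallP; exists c => //.
apply/has_otypeE; exists (f \o g); split; last by rewrite -gim image_comp.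
by move=> x y xc yc xy /=; apply: fS; rewrite -?gim; [exists x|exists y|exact: gS].
Qed.

Lemma small_seg b c : c < b -> small b (seg c).
Proof. by move=> cb; exists c, id; split. Qed.

(** The dichotomy behind the estimates of order types: to show that S has type
    less than b, assume a copy of b inside S and look for a contradiction. *)
Lemma small_or_embed a S b : S `<=` seg a ->
  small b S \/ exists f, strict_on (seg b) f /\ (forall d, d < b -> S (f d)).
Proof.
move=> Sa; have [//|//|c ca Sc] := @small_otype S id a.
have [cb|bc] := ltP c b; first by left; exact: has_otype_small Sc cb.
right; have /has_otypeE[f [fS fim]] := Sc; exists f; split.
  by apply: strict_on_sub fS => d; rewrite /seg /= => /lt_le_trans; exact.
by move=> d db; rewrite -fim; exists d => //; exact: lt_le_trans bc.
Qed.

(** * Ordinal sums and intervals *)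

Definition between (a c : Ord) : set Ord := [set d | a <= d < c].

Lemma between_subr a b c : b <= c -> between a b `<=` between a c.
Proof. by move=> bc d /andP[ad db]; rewrite /between /= ad (lt_le_trans db). Qed.

Lemma between_cat a b c : between a c `<=` between a b `|` between b c.
Proof.
by move=> d /andP[ad dc]; have [db|bd] := ltP d b; [left|right]; apply/andP.
Qed.

Lemma between_nil a c : c <= a -> between a c = set0.
Proof.
move=> ca; apply/seteqP; split=> // d /andP[ad dc].
by have := le_lt_trans ad dc; rewrite ltNge ca.
Qed.

Lemma seg_between c : seg c = between ozero c.
Proof. by apply/seteqP; split=> d; rewrite /seg /between /= ozero_le. Qed.

Lemma otype_sum (A B : wotype) : ord_add (otype A) (otype B) = otype (wo_sum A B).
Proof.
apply/otype_eq; have /asboolP[f [f' f'K fK] fm] := repr_otype A.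
have /asboolP[g [g' g'K gK] gm] := repr_otype B; apply/asboolP.
exists (fun x : wo_sum (repr (otype A)) (repr (otype B)) =>
  match x with inl a => inl (f a) | inr b => inr (g b) end : wo_sum A B).
  exists (fun x => match x with inl a => inl (f' a) | inr b => inr (g' b) end).
    by move=> [a|b]; rewrite ?f'K ?g'K.
  by move=> [a|b]; rewrite ?fK ?gK.
by move=> [a|b] [a'|b'] //=; rewrite /wo_le/= ?fm ?gm.
Qed.

(** The initial segments of a sum that end in the second summand are again sums;
    all the arithmetic needed about [ord_add] follows from this and [oseg_inl]. *)
Lemma oseg_inr (A B : wotype) (y : B) :
  oseg (inr y : wo_sum A B) = ord_add (otype A) (oseg y).
Proof.
rewrite otype_sum; apply/esym/otype_eq.
pose T := wo_restr (fun z : wo_sum A B => wo_lt z (inr y)).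
pose F (z : wo_sum A (wo_restr (fun z => wo_lt z y))) : T :=
  match z with
  | inl a => exist (fun z : wo_sum A B => wo_lt z (inr y)) (inl a) isT
  | inr b => exist (fun z : wo_sum A B => wo_lt z (inr y)) (inr (sval b)) (svalP b)
  end.
have Fsurj (t : T) : exists z, F z = t.
  case: t => [[a|b] tP]; first by exists (inl a); exact: val_inj.
  have bP : wo_lt b y by [].
  by exists (inr (exist _ b bP)); exact: val_inj.
by apply: (@wo_embed_surj _ _ F) => //; split=> // -[a|b] [a'|b'].
Qed.

Lemma oseg_inl (A B : wotype) (x : A) : oseg (inl x : wo_sum A B) < otype A.
Proof.
have -> : oseg (inl x : wo_sum A B) = oseg x; last exact: oseg_lt.
apply/esym/otype_eq; pose T := wo_restr (fun z : wo_sum A B => wo_lt z (inl x)).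
pose F (z : wo_restr (fun z => wo_lt z x)) : T :=
  exist (fun z : wo_sum A B => wo_lt z (inl x)) (inl (sval z)) (svalP z).
have Fsurj (t : T) : exists z, F z = t.
  case: t => [[a|b] tP //]; have aP : wo_lt a x by [].
  by exists (exist _ a aP); exact: val_inj.
by apply: (@wo_embed_surj _ _ F).
Qed.

Lemma ord_add_ltl a c d : d < c -> ord_add a d < ord_add a c.
Proof.
rewrite -{1}(otype_repr c) => /oseg_surj[y <-].
rewrite -{1}(otype_repr a) -oseg_inr; exact: oseg_lt.
Qed.

Lemma ord_add_ge a c : a <= ord_add a c.
Proof.
rewrite -{1}(otype_repr a) otype_le; apply/asboolP.
by exists inl; split=> // x [a' _|//]; exists a'.
Qed.

Lemma ord_add_inv a c x : a <= x -> x < ord_add a c -> exists2 d, d < c & x = ord_add a d.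
Proof.
move=> ax /oseg_surj[[y|y] yx].
  by have := oseg_inl (repr c) y; rewrite yx otype_repr ltNge ax.
exists (oseg y); first by rewrite -{2}(otype_repr c) oseg_lt.
by rewrite -yx oseg_inr otype_repr.
Qed.

Lemma ord_add_strict a S : strict_on S (ord_add a).
Proof. by move=> x y _ _; exact: ord_add_ltl. Qed.

Lemma ord_add_surj a x : a <= x -> exists d, x = ord_add a d.
Proof.
move=> ax; have xax : x <= ord_add a x.
  rewrite leNgt; apply/negP => h.
  have := @strict_on_seg_ge x (ord_add a) (@ord_add_strict a _) _ h.
  rewrite leNgt => /negP; apply; exact: ord_add_ltl.
by move: xax; rewrite le_eqVlt => /predU1P[|/(ord_add_inv ax)[d _]]; [exists x|exists d].
Qed.

Lemma between_add a c : between a (ord_add a c) = ord_add a @` seg c.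
Proof.
apply/seteqP; split=> [x /andP[ax xac]|_ [d dc <-]].
  by have [d dc ->] := ord_add_inv ax xac; exists d.
by rewrite /between /= ord_add_ge ord_add_ltl.
Qed.

Lemma between_add_card a c : between a (ord_add a c) #= seg c.
Proof. by rewrite between_add; apply/inj_card_eq/strict_on_inj/ord_add_strict. Qed.

Lemma omega_gt0 : ozero < omega.
Proof. exact: ord_gt0 (oseg_lt (0%N : WOType nat_wo)). Qed.

Lemma omega1_gt0 : ozero < omega1.
Proof.
rewrite ltNge; apply/negP => o10; have [+ _] := omega1P.
by rewrite seg_between between_nil.
Qed.

Lemma countable_seg_omega : countable (seg omega).
Proof.
apply: (@subset_countable _ _ [set oseg (n : WOType nat_wo) | n in setT]).
  by move=> d /oseg_surj[n <-]; exists n.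
by apply: sub_countable (countableP [set: nat]); exact: card_image_le.
Qed.

Lemma infinite_seg_omega : infinite_set (seg omega).
Proof.
move=> h; apply: infinite_nat.
apply: (inj_finite (f := @oseg (WOType nat_wo))) h => [m n _ _ E|n _].
  by apply: (@wo_le_anti (WOType nat_wo)); rewrite -oseg_le E.
exact: oseg_lt.
Qed.

Lemma finite_seg d : d < omega -> finite_set (seg d).
Proof.
move=> /oseg_surj[n <-].
apply: (@sub_finite_set _ _ [set oseg (m : WOType nat_wo) | m in `I_n]).
  move=> e en; have /oseg_surj[m E] : e < omega by apply: lt_trans en _; exact: oseg_lt.
  exists m => //; move: en; rewrite -E /seg /= ltNge oseg_le /wo_le /=.
  by rewrite -ltnNge.
exact/finite_image/finite_II.
Qed.

Lemma infinite_between_omega b : infinite_set (between b (ord_add b omega)).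
Proof. by rewrite (eq_finite_set (between_add_card _ _)); exact: infinite_seg_omega. Qed.

Lemma finite_between b d : d < ord_add b omega -> finite_set (between b d).
Proof.
have [bd|/ltW/between_nil-> _] := leP b d; last exact: finite_set0.
move=> /(ord_add_inv bd)[e eo ->].
by rewrite (eq_finite_set (between_add_card _ _)); exact: finite_seg.
Qed.

Lemma countable_between a d : d < ord_add a omega1 -> countable (between a d).
Proof.
have [ad|/ltW/between_nil-> _] := leP a d; last exact: countable0.
move=> /(ord_add_inv ad)[e eo ->].
rewrite (eq_countable (between_add_card _ _)); exact: (proj2 omega1P).
Qed.

(** * Ordinals that absorb countable sets *)

(** The fixed points of [star] ([thick_star], [star_thick]): zero and the
    nonzero multiples of omega1. *)
Definition thick (b : Ord) := forall h, h < b -> ~ countable (between h b).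

Lemma closed_interval a b : a <= b -> [set d | a <= d <= b] = between a b `|` [set b].
Proof.
move=> ab; apply/seteqP; split=> [d /= /andP[ad]|d [/andP[ad db]|->]] /=.
- by rewrite le_eqVlt => /predU1P[|db]; [right|left; rewrite /between /= ad db].
- by rewrite ad ltW.
- by rewrite ab lexx.
Qed.

Lemma countable_closed a b : a <= b ->
  countable [set d | a <= d <= b] <-> countable (between a b).
Proof.
move=> ab; rewrite closed_interval//; split; first by apply: subset_countable => d; left.
by move=> h; apply: countableU => //; exact: countable1.
Qed.

Lemma star_le b : star b <= b. Proof. by have [] := starP b. Qed.

Lemma star_countable b : countable (between (star b) b).
Proof. by have [sb h _] := starP b; apply/countable_closed. Qed.

Lemma star_min b c : c <= b -> countable (between c b) -> star b <= c.
Proof.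
by move=> cb h; have [_ _ smin] := starP b; apply: smin => //; apply/countable_closed.
Qed.

Lemma star_thick b : thick (star b).
Proof.
move=> h hs ch; have : star b <= h; last by rewrite leNgt hs.
apply: star_min; first exact: le_trans (ltW hs) (star_le b).
exact: subset_countable (@between_cat h (star b) b) (countableU ch (star_countable b)).
Qed.

Lemma thick_star b : thick b -> star b = b.
Proof.
move=> tb; apply/le_anti; rewrite star_le leNgt; apply/negP => /tb; apply.
exact: star_countable.
Qed.

Lemma thick_omega b : thick b -> ozero < b -> omega <= b.
Proof.
move=> tb b0; rewrite leNgt; apply/negP => bo; apply: (tb ozero b0).
rewrite -seg_between; exact/finite_set_countable/finite_seg.
Qed.

Lemma thick_succ b h : thick b -> h < b -> exists2 h', h < h' & h' < b.
Proof.
move=> tb hb; apply: contrapT => nh; apply: (tb h hb).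
apply: subset_countable (countable1 h) => d /andP[hd db] /=.
by move: hd; rewrite le_eqVlt => /predU1P[//|hd]; case: nh; exists d.
Qed.

(** Suppose that g embeds into the union. The elements of g that land in A form a
    subset C with countable complement, and r maps C increasingly into some h < g.
    The set V x of those s in C with r s < x <= s is countable for every x: if t is
    its least element, then [r t, x) minus C is countable and the rest of [r t, x)
    is contained in V (r t), which is countable by induction; and r maps V x
    injectively into [r t, x). For x = h this makes [h, g) countable. *)
Lemma small_countableU a g A B : thick g -> A `|` B `<=` seg a ->
  small g A -> countable B -> small g (A `|` B).
Proof.
move=> tg ABa [h [f [hg fA fh]]] cB.
have [//|[k [kg kAB]]] := small_or_embed g ABa; exfalso.
pose C := [set s | s < g /\ A (k s)]; pose r s := f (k s).
have Cr : strict_on C r.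
  by move=> x y [xg Ax] [yg Ay] xy; apply: fA => //; exact: kg.
have cD : countable (seg g `\` C).
  apply: (inj_countable (f := k)) cB; last first.
    by move=> x [xg nC]; have [Ak|//] := kAB _ xg; case: nC.
  move=> x y /set_mem[xg _] /set_mem[yg _].
  by apply: (strict_on_inj kg); apply/mem_set.
have cV x : countable [set s | C s /\ r s < x <= s].
  elim/ord_ind: x => x IH.
  have [|none] := pselect ([set s | C s /\ r s < x <= s] !=set0); last first.
    by apply: subset_countable (countable0 Ord) => s ?; apply: none; exists s.
  move=> /ord_min[t [Ct /andP[rtx xt]] tmin].
  have cI : countable (between (r t) x).
    apply: (@subset_countable _ _ ((seg g `\` C) `|` [set s | C s /\ r s < r t <= s])).
      move=> s /andP[rts sx]; have st := lt_le_trans sx xt.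
      have sg : s < g by apply: lt_trans st _; case: Ct.
      have [Cs|nCs] := pselect (C s); last by left.
      by right; split=> //; rewrite rts Cr.
    by apply: countableU => //; exact: IH.
  apply: (inj_countable (f := r)) cI => [u v /set_mem[Cu _] /set_mem[Cv _]|u Vu].
    by apply: (strict_on_inj Cr); apply/mem_set.
  have [Cu /andP[rux _]] := Vu; rewrite /between /= rux andbT.
  by rewrite (strict_on_le Cr)//; exact: tmin.
apply: (tg h hg); apply: subset_countable (countableU cD (cV h)) => s /andP[hs sg].
have [Cs|nCs] := pselect (C s); last by left.
by right; split=> //; rewrite hs andbT; apply: fh; case: Cs.
Qed.

(** A copy of b + omega inside S would place infinitely many elements of S at or
    above b, since increasing maps do not lower ordinals. *)
Lemma small_finite a b S : S `<=` seg a -> finite_set (S `\` seg b) ->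
  small (ord_add b omega) S.
Proof.
move=> Sa finS; have [//|[f [fS fim]]] := small_or_embed (ord_add b omega) Sa.
case: (@infinite_between_omega b); apply: (inj_finite (f := f)) finS.
  by move=> x y /set_mem/andP[_ xb] /set_mem/andP[_ yb];
    apply: (strict_on_inj fS); apply/mem_set.
move=> x /andP[bx xb]; split; first exact: fim.
by apply/negP; rewrite -leNgt (le_trans bx)// (strict_on_seg_ge fS).
Qed.

(** * Compactness *)

Lemma ord_succ : exists s : Ord -> Ord, forall x y, x < y -> x < s x /\ s x <= y.
Proof.
suff /choice[s sP] : forall x, exists z, forall y : Ord, x < y -> x < z /\ z <= y.
  by exists s => x; exact: sP.
move=> x; have [[y xy]|ny] := pselect (exists y, x < y); last first.
  by exists x => y xy; case: ny; exists y.
have [|z xz zmin] := @ord_min [set z | x < z]; first by exists y.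
by exists z => t xt; split=> //; exact: zmin.
Qed.

Definition is_cover (X : Type) (D : set Ord) (O : Ord -> set X) : Prop :=
  \bigcup_(d in D) O d = setT.

Lemma is_coverP X (D : set Ord) (O : Ord -> set X) :
  is_cover D O <-> forall x, exists2 d, D d & O d x.
Proof.
split=> [DO x|h].
  by have : [set: X] x by []; rewrite -DO => -[d Dd Odx]; exists d.
by apply/seteqP; split=> // x _; have [d Dd Odx] := h x; exists d.
Qed.

Section Compact.
Variables (X : Type) (tau : set (set X)).
Hypothesis X_nonempty : [set: X] !=set0.

Lemma compact_ccP b a : compact_cc tau b a <->
  forall O, (forall d, d < a -> tau (O d)) -> is_cover (seg a) O ->
  exists H, [/\ H `<=` seg a, small b H & is_cover H O].
Proof.
split=> h O Ot Oc; have [H [Ha Hb Hc]] := h O Ot Oc; exists H; split=> //;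
exact/smallP.
Qed.

Lemma cover_nonempty (D : set Ord) (O : Ord -> set X) : is_cover D O -> D !=set0.
Proof. by move=> /is_coverP h; have [x _] := X_nonempty; have [d Dd _] := h x; exists d. Qed.

(** Compactness can be applied to a family indexed by any set D of ordinals and
    rearranged by an injection phi of D into a. The indices that are not used by
    phi are filled with the member d0 that comes first. This may put phi d0 into
    the image of a subcover without its having been one of the chosen indices; the
    type does not grow, because an unused index e0 was chosen instead: d0 becomes
    the new first element and the elements before e0 are shifted by one. *)
Lemma compact_reindex b a (D : set Ord) (O : Ord -> set X) (phi : Ord -> Ord) :
  compact_cc tau b a -> (forall d, D d -> tau (O d)) -> is_cover D O ->
  {in D &, injective phi} -> (forall d, D d -> phi d < a) ->
  exists K, [/\ K `<=` D, small b (phi @` K) & is_cover K O].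
Proof.
move=> /compact_ccP cpt Ot DO phiinj phia.
have [|_ [d0 Dd0 <-] d0min] := @ord_min (phi @` D).
  by have [d Dd] := cover_nonempty DO; exists (phi d), d.
have [psi psiP] : exists psi : Ord -> Ord, forall e,
    D (psi e) /\ (phi (psi e) = e \/ psi e = d0 /\ ~ (phi @` D) e).
  suff /choice[psi psiP] : forall e, exists d, D d /\ (phi d = e \/ d = d0 /\ ~ (phi @` D) e).
    by exists psi.
  move=> e; have [[d Dd de]|ne] := pselect ((phi @` D) e); first by exists d; split=> //; left.
  by exists d0; split=> //; right.
have psiK d : D d -> psi (phi d) = d.
  move=> Dd; have [Dp [E|[_ []]]] := psiP (phi d); last by exists d.
  by apply: phiinj => //; exact/mem_set.
have [e _||H [Ha [c [f [cb fH fc]]] /is_coverP Hc]] := cpt (O \o psi).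
- by apply: Ot; have [] := psiP e.
- apply/is_coverP => x; have /is_coverP/(_ x)[d Dd Odx] := DO.
  by exists (phi d); [exact: phia|rewrite /= psiK].
exists (psi @` H); split; last first.
- by apply/is_coverP => x; have [d Hd Odx] := Hc x; exists (psi d) => //; exists d.
- exists c; have [[e0 He0 ne0]|all] := pselect (exists2 e, H e & ~ (phi @` D) e); last first.
    have allE e : H e -> phi (psi e) = e.
      by move=> He; have [_ [//|[_ ne]]] := psiP e; case: all; exists e.
    exists f; split=> // [_ _ [_ [e He <-] <-] [_ [e' He' <-] <-]|_ [_ [e He <-] <-]];
      rewrite !allE//; [exact: fH|exact: fc].
  have [s sP] := ord_succ.
  have sf e : H e -> e < e0 -> f e < s (f e) /\ s (f e) <= f e0.
    by move=> He ee0; apply: sP; exact: fH.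
  (* [s] is the successor: [g] shifts the elements before e0 to make room for 0. *)
  pose g x := if x == phi d0 then ozero else if x < e0 then s (f x) else f x.
  have gP x : (phi @` (psi @` H)) x -> x <> phi d0 ->
      [/\ H x, phi d0 < x, x <> e0 & f x <= g x /\ (x < e0 -> g x <= f e0)].
    move=> [_ [e He <-] <-] nd0; have [Dpe [E|[E _]]] := psiP e; last by rewrite E in nd0.
    have d0e : phi d0 < phi (psi e).
      by rewrite lt_neqAle eq_sym; apply/andP; split; [exact/eqP|apply: d0min; exists (psi e)].
    rewrite !E in nd0 d0e *; split=> //; first by
      move=> ee0; apply: ne0; exists (psi e) => //; rewrite E.
    rewrite /g ifN ?gt_eqF//; case: ifP => [ee0|//].
    by have [/ltW ? ?] := sf e He ee0.
  have g0 : g (phi d0) = ozero by rewrite /g eqxx.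
  have gpos x : (phi @` (psi @` H)) x -> x <> phi d0 -> ozero < g x.
    move=> Kx nx; have [Hx d0x xe0 [fg _]] := gP x Kx nx.
    have [xlt|ltx|E //] := ltgtP x e0.
      rewrite /g ifN ?gt_eqF// xlt; apply: ord_gt0 (proj1 (sf _ Hx xlt)).
    by apply: lt_le_trans fg; apply: ord_gt0 (fH _ _ He0 Hx ltx).
  have gc x : (phi @` (psi @` H)) x -> g x < c.
    move=> Kx; have [->|nx] := pselect (x = phi d0).
      by rewrite g0; exact: ord_gt0 (fc _ He0).
    have [Hx d0x xe0 [_ ge0]] := gP x Kx nx.
    have [xlt|lex] := ltP x e0; first exact: le_lt_trans (ge0 xlt) (fc _ He0).
    by rewrite /g ifN ?gt_eqF// ifN -?leNgt//; exact: fc.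
  exists g; split=> // x y Kx Ky xy.
  have ny : y <> phi d0.
    move=> E; have [xd0|nx] := pselect (x = phi d0); first by rewrite xd0 E ltxx in xy.
    by have [_ + _ _] := gP x Kx nx; rewrite -E ltNge (ltW xy).
  have [->|nx] := pselect (x = phi d0); first by rewrite g0; exact: gpos.
  have [Hx d0x xe0 [_ gx]] := gP x Kx nx; have [Hy d0y ye0 [fy gy]] := gP y Ky ny.
  have [ylt|yge|//] := ltgtP y e0.
    have xlt := lt_trans xy ylt.
    rewrite /g !gt_eqF// xlt ylt.
    have [_ sx] := sP _ _ (fH _ _ Hx Hy xy).
    by apply: le_lt_trans sx _; have [] := sf y Hy ylt.
  have [xlt|xge] := ltP x e0.
    by apply: le_lt_trans (gx xlt) _; apply: lt_le_trans fy; exact: fH.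
  apply: lt_le_trans fy; rewrite /g gt_eqF// ifN -?leNgt//; exact: fH.
by move=> _ [e He <-]; have [] := psiP e.
Qed.

Lemma compact_mono b b' a a' : b <= b' -> a' <= a ->
  compact_cc tau b a -> compact_cc tau b' a'.
Proof.
move=> bb' aa' cpt; apply/compact_ccP => O Ot Oc.
have [||K [Ka Kb Kc]] := compact_reindex (phi := id) cpt Ot Oc.
- by move=> x y.
- by move=> d da; exact: lt_le_trans aa'.
by rewrite image_id in Kb; exists K; split=> //; exact: small_leW Kb.
Qed.

Lemma T1_finite (F : set X) (U : set X) : T1_family tau -> tau U -> finite_set F ->
  tau (U `\` F).
Proof.
move=> T1 tU [n]; elim: n F => [|n IH] F.
  by rewrite II0 card_eq0 => /eqP->; rewrite setD0.
move=> /eq_cardSP[x Fx /IH tUF]; rewrite (_ : U `\` F = (U `\` (F `\ x)) `\ x); last first.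
  by rewrite setDDl setUC setD1K.
have [Ux|nUx] := pselect ((U `\` (F `\ x)) x); first exact: T1.
by rewrite not_setD1.
Qed.

(** * Essential indices in T1 spaces *)

(** The step that uses T1. The indices in E are essential and move to the end
    segment [b, beta), while the others stay where they are. Deleting superfluous
    points forces every subcover to contain E. *)
Lemma compact_essential a b beta (D E : set Ord) (O : Ord -> set X) :
  T1_family tau -> compact_cc tau beta beta ->
  thick b -> b < beta -> countable (between b beta) ->
  D `<=` seg a -> E `<=` D -> D `\` E `<=` seg b -> E #= between b beta ->
  (forall d, D d -> tau (O d)) -> is_cover D O ->
  (forall e, E e -> exists2 x, O e x & forall d, D d -> d < e -> ~ O d x) ->
  (forall d, D d -> finite_set [set e | E e /\ e < d]) ->
  exists K, [/\ K `<=` D, small b K & is_cover K O].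
Proof.
move=> T1 cpt tb bbeta cb Da ED DEb Ecard Ot /is_coverP DO Ess Efin.
have [p pP] : exists p : Ord -> X, forall e, E e -> O e (p e) /\
    forall d, D d -> d < e -> ~ O d (p e).
  have [x0 _] := X_nonempty.
  suff /choice[p pP] : forall e, exists x, E e -> O e x /\
      forall d, D d -> d < e -> ~ O d x by exists p.
  move=> e; have [Ee|nE] := pselect (E e); last by exists x0.
  by have [x ? ?] := Ess e Ee; exists x.
pose O' d := O d `\` (p @` [set e | E e /\ e < d]).
have O't d : D d -> tau (O' d).
  by move=> Dd; apply: T1_finite (Ot _ Dd) _ => //; apply/finite_image/Efin.
have pO' e : E e -> O' e (p e).
  move=> Ee; have [Oep pn] := pP e Ee; split=> // -[e' [Ee' e'e] pe].
  by have [Oe'p _] := pP e' Ee'; apply: (pn e' (ED _ Ee') e'e); rewrite -pe.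
have O'p e d : E e -> D d -> O' d (p e) -> d = e.
  move=> Ee Dd [Odp nd]; have [_ pn] := pP e Ee.
  have [de|ed|//] := ltgtP d e; first by case: (pn d Dd de).
  by case: nd; exists e.
have O'c : is_cover D O'.
  apply/is_coverP => x; have [[e Ee pe]|np] := pselect (exists2 e, E e & p e = x).
    by exists e; [exact: ED|rewrite -pe; exact: pO'].
  by have [d Dd Odx] := DO x; exists d => //; split=> // -[e [Ee _] pe]; apply: np; exists e.
have [g [ginj gim]] := card_eq_inj Ecard.
have gE e : E e -> b <= g e < beta.
  by move=> Ee; have : between b beta (g e) by rewrite -gim; exists e.
pose phi d := if `[< E d >] then g d else d.
have phiE d : E d -> phi d = g d by move=> Ed; rewrite /phi asboolT.
have phiN d : ~ E d -> phi d = d by move=> Ed; rewrite /phi asboolF.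
have [|d Dd|K [KD [c [f [cbeta fK fc]]] Kc]] := compact_reindex (phi := phi) cpt O't O'c.
- have sep d e : D d -> ~ E d -> E e -> d = g e -> False.
    move=> Dd nEd Ee dg; have /andP[] := gE e Ee.
    by rewrite -dg leNgt (DEb d).
  move=> d e /set_mem Dd /set_mem De.
  have [Ed|Ed] := pselect (E d); have [Ee|Ee] := pselect (E e).
  + by rewrite !phiE// => gde; apply: ginj => //; exact/mem_set.
  + by rewrite phiE// phiN// => /esym/(sep e d De Ee Ed).
  + by rewrite phiN// phiE// => /(sep d e Dd Ed Ee).
  + by rewrite !phiN.
- have [Ed|Ed] := pselect (E d); first by rewrite phiE//; have /andP[] := gE d Ed.
  by rewrite phiN//; apply: lt_trans bbeta; exact: DEb.
exists K; split=> //; last first.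
  by move/is_coverP: Kc => Kc; apply/is_coverP => x; have [d Kd [Odx _]] := Kc x; exists d.
have EK : E `<=` K.
  move=> e Ee; move/is_coverP: Kc => /(_ (p e))[d Kd /O'p-/(_ Ee)<-//].
  exact: KD.
have phiK d : b <= d < beta -> (phi @` K) d.
  by move=> bd; have : between b beta d by []; rewrite -gim => -[e Ee <-]; exists e;
    [exact: EK|rewrite phiE].
(* Otherwise f would lower nothing on [b, beta), in particular not c. *)
have fb : f b < b.
  rewrite ltNge; apply/negP => bfb.
  have bc : b <= c by apply: le_trans bfb (ltW _); apply: fc; apply: phiK; rewrite lexx.
  have : c <= f c.
    apply: (@strict_on_ge b beta f _ _ c); rewrite ?bc//.
    by move=> x y bx yb; apply: fK; exact: phiK.
  by rewrite leNgt fc//; apply: phiK; rewrite bc.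
have -> : K = (K `\` E) `|` E by rewrite setUC setDUK.
have KEb d : (K `\` E) d -> [/\ d < b, (phi @` K) d & phi d = d].
  move=> [Kd nE]; split; [by apply: DEb; split; [exact: KD|]| |exact: phiN].
  by exists d => //; exact: phiN.
apply: (@small_countableU a) => //.
- by move=> d [[/KD/Da]|/ED/Da].
- exists (f b), f; split=> // [x y /KEb[_ Kx _] /KEb[_ Ky _]|d /KEb[db Kd _]].
    exact: fK.
  by apply: fK => //; apply: phiK; rewrite lexx.
- by rewrite (eq_countable Ecard).
Qed.

(** If there are no essential indices in [h, b), then the members of index less
    than h already cover the space. *)
Lemma seg_essential b (O : Ord -> set X) h :
  (forall K, K `<=` seg b -> small b K -> ~ is_cover K O) -> is_cover (seg b) O -> h < b ->
  exists e, [/\ h <= e, e < b & exists2 x, O e x & forall d, d < e -> ~ O d x].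
Proof.
move=> nK /is_coverP Oc hb; apply: contrapT => nex.
apply: (nK (seg h)) => [d dh||]; [exact: lt_trans hb|exact: small_seg|].
apply/is_coverP => x; have [d0 d0b Od0] := Oc x.
have [|e Oe emin] := @ord_min [set d | O d x]; first by exists d0.
exists e => //; rewrite /seg /= ltNge; apply/negP => he; apply: nex; exists e; split=> //.
  by apply: le_lt_trans d0b; exact: emin.
by exists x => // d de /emin; rewrite leNgt de.
Qed.

Lemma cf_omega_seq b : cf b = omega ->
  ozero < b /\ exists c : nat -> Ord, (forall n, c n < b) /\
    (forall d, d < b -> exists n, forall m, (n <= m)%N -> d <= c m).
Proof.
move=> cfb; have [C [Cb Ccof]] := cfP b; rewrite cfb => /has_otypeE[f [fS fC]].
pose c (n : nat) := f (oseg (n : WOType nat_wo)).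
have so (n : nat) : seg omega (oseg (n : WOType nat_wo)) by exact: oseg_lt.
have cb n : c n < b by apply: Cb; rewrite -fC; exists (oseg (n : WOType nat_wo)).
split; first exact: ord_gt0 (cb 0%N).
exists c; split=> // d /Ccof[e]; rewrite -fC => -[_ /oseg_surj[n <-] <-] dc.
exists n => m nm; apply: le_trans dc _.
by rewrite /c (strict_on_le fS)// oseg_le.
Qed.

(** The clause beta = star beta + n in the definition of [star2] says that
    [star beta, beta) is finite. *)
Lemma star2_cases beta : omega <= beta ->
  [\/ [/\ star2 beta = star beta, ozero < star beta & finite_set (between (star beta) beta)],
      [/\ star2 beta = star beta, cf (star beta) = omega
        & infinite_set (between (star beta) beta)] |
      star2 beta = ord_add (star beta) omega /\ infinite_set (between (star beta) beta)].
Proof.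
move=> ob; have [fin|inf] := pselect (finite_set (between (star beta) beta)).
  apply: Or31; split=> //; last first.
    rewrite lt_neqAle ozero_le andbT; apply/eqP => b0.
    apply: infinite_seg_omega; apply: sub_finite_set fin => d dO.
    by rewrite -b0 -seg_between; exact: lt_le_trans ob.
  rewrite /star2 asboolT//; right.
  have [n nE] := ord_add_surj (star_le beta); exists n => //.
  rewrite ltNge; apply/negP => on; apply: infinite_seg_omega.
  move: fin; rewrite {2}nE (eq_finite_set (between_add_card _ _)).
  by apply: sub_finite_set => d /lt_le_trans; exact.
have [cfo|cfo] := pselect (cf (star beta) = omega).
  by apply: Or32; split=> //; rewrite /star2 asboolT//; left.
apply: Or33; split=> //; rewrite /star2 asboolF// => -[//|[n no nE]].
by apply: inf; rewrite {2}nE (eq_finite_set (between_add_card _ _)); exact: finite_seg.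
Qed.

Lemma infinite_between_le b beta : infinite_set (between b beta) -> ord_add b omega <= beta.
Proof. by move=> inf; rewrite leNgt; apply/negP => /finite_between. Qed.

Lemma star2_le beta : omega <= beta -> star2 beta <= beta.
Proof.
move=> /star2_cases[[-> _ _]|[-> _ _]|[-> /infinite_between_le//]]; exact: star_le.
Qed.

Lemma star2_gt0 beta : omega <= beta -> ozero < star2 beta.
Proof.
move=> /star2_cases[[->]|[-> /cf_omega_seq[]]|[-> _]] //.
exact: ord_gt0 (ord_add_ltl _ omega_gt0).
Qed.

Lemma infinite_countable_card T U (A : set T) (B : set U) :
  infinite_set A -> countable A -> infinite_set B -> countable B -> A #= B.
Proof.
move=> iA cA iB cB; apply: (@card_eq_trans _ _ _ _ [set: nat]); last rewrite card_eq_sym.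
  by rewrite card_eq_le; apply/andP; split=> //; exact/infiniteP.
by rewrite card_eq_le; apply/andP; split=> //; exact/infiniteP.
Qed.

Lemma finite_bounded b (F : set Ord) : thick b -> ozero < b -> F `<=` seg b ->
  finite_set F -> exists2 h, h < b & forall e, F e -> e < h.
Proof.
move=> tb b0 + [n]; elim: n F => [|n IH] F Fb.
  by rewrite II0 card_eq0 => /eqP->; exists ozero.
move=> /eq_cardSP[x Fx /IH[|h hb hF]]; first by move=> d [/Fb].
have [x' xx' x'b] := thick_succ tb (Fb _ Fx).
exists (Order.max h x'); first by rewrite gt_max hb.
move=> e Fe; rewrite lt_max; have [->|/eqP ne] := pselect (e = x); first by rewrite xx' orbT.
by rewrite hF//; split=> // /eqP; apply/negP.
Qed.

(** The least index of a member containing x is essential, so the essential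
    indices always form a subcover. *)
Lemma essential_cover (D E : set Ord) (O : Ord -> set X) :
  (forall d, D d -> (exists2 x, O d x & forall d', d' < d -> ~ O d' x) -> E d) ->
  (forall x, exists e, D e /\ O e x /\ forall d, O d x -> e <= d) -> is_cover E O.
Proof.
move=> DE h; apply/is_coverP => x; have [e [De [Oe emin]]] := h x.
by exists e => //; apply: DE => //; exists x => // d de /emin; rewrite leNgt de.
Qed.

Lemma cover_least (a : Ord) (O : Ord -> set X) x : is_cover (seg a) O ->
  exists e, seg a e /\ O e x /\ forall d, O d x -> e <= d.
Proof.
move=> /is_coverP/(_ x)[d da Od].
have [|e Oe emin] := @ord_min [set d | O d x]; first by exists d.
by exists e; split=> //; apply: le_lt_trans da; exact: emin.
Qed.

(** The set E for [compact_essential]. If [b, beta) is finite, any subset of the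
    essential indices of the right cardinality will do. If b has cofinality omega,
    choose essential indices above the terms of a cofinal sequence, so that only
    finitely many of them lie below any given index. Otherwise the cover has length
    b + omega, and all essential indices at or above b are used. *)
Lemma compact_star2 beta : T1_family tau -> omega <= beta ->
  compact_cc tau beta beta -> compact_cc tau (star2 beta) (star2 beta).
Proof.
move=> T1 ob cpt; have tb := @star_thick beta; have cb := @star_countable beta.
have [->//|neq] := eqVneq (star2 beta) beta.
have bbeta : star beta < beta.
  rewrite lt_neqAle star_le andbT; apply/eqP => E; move/eqP: neq; apply.
  have := star2_cases ob; rewrite E => -[[]|[_ _]|[_]] //;
  by rewrite between_nil//; case; exact: finite_set0.
have cases := star2_cases ob; set b := star beta in tb cb bbeta cases.
have smallcase : ozero < b -> cf b = omega \/ finite_set (between b beta) ->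
    compact_cc tau b b.
  move=> b0 hb; apply/compact_ccP => O Ot Oc; apply: contrapT => nK0.
  have nK K : K `<=` seg b -> small b K -> ~ is_cover K O.
    by move=> Kb sK Kc; apply: nK0; exists K.
  pose E' := [set e | e < b /\ exists2 x, O e x & forall d, d < e -> ~ O d x].
  have E'n : ~ countable E'.
    move=> cE; apply: (nK E'); first by move=> d [].
      rewrite -(set0U E'); apply: (@small_countableU b) => //; first by move=> d [//|[]].
      by exists ozero, id; split.
    by apply: essential_cover (fun x => cover_least x Oc) => d db ess; split.
  have key E : E `<=` E' -> E #= between b beta ->
      (forall d, d < b -> finite_set [set e | E e /\ e < d]) -> False.
    move=> EE' Ec Efin.
    have [|||||K [KD sK Kc]] :=
      compact_essential (a := b) (D := seg b) T1 cpt tb bbeta cb _ _ _ Ec _ Oc _ Efin.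
    - by [].
    - by move=> d /EE'[].
    - by move=> d [].
    - exact: Ot.
    - by move=> e /EE'[_ [x Ox xn]]; exists x => // d _; exact: xn.
    - exact: nK Kc.
  have [fin|inf] := pselect (finite_set (between b beta)).
    have /card_le_inj[g [ginj gE]] : between b beta #<= E'.
      apply: card_le_trans cb _; apply/infiniteP => finE'; apply: E'n.
      exact: finite_set_countable.
    apply: (key (g @` between b beta)); [by move=> _ [d bd <-]; exact: gE|exact: inj_card_eq|].
    by move=> d _; apply: sub_finite_set (finite_image g fin) => e [].
  have [cfb|//] := hb; have [_ [c [cltb ccof]]] := cf_omega_seq cfb.
  have [e eP] : exists e : nat -> Ord, forall n, c n <= e n /\ E' (e n).
    suff /choice[e eP] : forall n, exists d, c n <= d /\ E' d by exists e.
    move=> n; have [d [cd db ess]] := seg_essential nK Oc (cltb n).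
    by exists d; split=> //; split.
  apply: (key (range e)) => [_ [n _ <-]||d db]; first by have [] := eP n.
    apply: infinite_countable_card => //.
      move=> fine; have [|h hb' hmax] := finite_bounded tb b0 _ fine.
        by move=> _ [n _ <-]; have [_ []] := eP n.
      have [n /(_ n (leqnn n)) hc] := ccof h hb'.
      have : e n < h by apply: hmax; exists n.
      by rewrite ltNge (le_trans hc)//; have [] := eP n.
    by apply: sub_countable (countableP [set: nat]); exact: card_image_le.
  have [n nP] := ccof d db.
  apply: sub_finite_set (finite_image e (finite_II n)) => _ [[m _ <-] emd].
  exists m => //=; rewrite ltnNge; apply/negP => nm.
  have := le_trans (nP m nm) (proj1 (eP m)); by rewrite leNgt emd.
case: cases => [[-> b0 fin]|[-> cfb inf]|[-> inf]].
- by apply: smallcase => //; right.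
- by apply: smallcase => //; [have [] := cf_omega_seq cfb|left].
apply/compact_ccP => O Ot Oc; apply: contrapT => nK.
pose E := [set e | b <= e < ord_add b omega /\ exists2 x, O e x & forall d, d < e -> ~ O d x].
pose D := seg b `|` E.
have Dbo : D `<=` seg (ord_add b omega).
  by move=> d [db|[/andP[]//]]; apply: lt_le_trans (ord_add_ge _ _).
have Dc : is_cover D O.
  apply: essential_cover (fun x => cover_least x Oc) => d db ess.
  by have [dltb|bd] := ltP d b; [left|right; split=> //; rewrite bd].
have Einf : infinite_set E.
  move=> Efin; apply: nK; exists D; split=> //; apply: small_finite Dbo _.
  by apply: sub_finite_set Efin => d [[]].
have Ecount : countable E.
  apply: (@subset_countable _ _ (between b (ord_add b omega))); first by move=> d [].
  by rewrite (eq_countable (between_add_card _ _)); exact: countable_seg_omega.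
have [||||||K [KD sK Kc]] :=
    compact_essential T1 cpt tb bbeta cb Dbo (E := E) _ _ _ _ Dc _ _.
- by move=> d; right.
- by move=> d [[]].
- exact: infinite_countable_card.
- by move=> d /Dbo/Ot.
- by move=> e [_ [x Ox xn]]; exists x => // d _; exact: xn.
- by move=> d /Dbo dbo; apply: sub_finite_set (finite_between dbo) => e [[/andP[be _] _] ed];
    apply/andP.
apply: nK; exists K; split=> //; first exact: subset_trans KD Dbo.
by apply: small_leW sK; exact: ord_add_ge.
Qed.

(** * Shortening covers *)

(** The rearrangement fixes [omega, g) and maps the countably many other indices
    into omega. It changes only countably many indices, so by [small_countableU]
    smallness in the new order is smallness in the old one. *)
Lemma compact_absorb g z (O : Ord -> set X) : thick g -> ozero < g ->
  compact_cc tau g g -> countable (between g z) ->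
  (forall d, d < z -> tau (O d)) -> is_cover (seg z) O ->
  exists K, [/\ K `<=` seg z, small g K & is_cover K O].
Proof.
move=> tg g0 cpt cgz Ot Oc; have og := thick_omega tg g0.
pose N := seg omega `|` between g z.
have [j [jinj jo]] : exists j : Ord -> Ord, {in N &, injective j} /\
    forall d, N d -> j d < omega.
  apply: (card_le_inj (B := seg omega)).
  apply: card_le_trans (countableU countable_seg_omega cgz) _.
  exact/infiniteP/infinite_seg_omega.
pose phi d := if `[< N d >] then j d else d.
have phiN d : N d -> phi d = j d by move=> Nd; rewrite /phi asboolT.
have phiE d : ~ N d -> phi d = d by move=> Nd; rewrite /phi asboolF.
have notN d : d < z -> ~ N d -> omega <= d < g.
  move=> dz nN; apply/andP; split; first by rewrite leNgt; apply/negP => h; apply: nN; left.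
  by rewrite ltNge; apply/negP => h; apply: nN; right; rewrite /between /= h.
have [d e /set_mem dz /set_mem ez|d dz|K [Kz sK Kc]] := compact_reindex (phi := phi) cpt Ot Oc.
- have [Nd|Nd] := pselect (N d); have [Ne|Ne] := pselect (N e).
  + by rewrite !phiN// => jde; apply: jinj => //; exact/mem_set.
  + rewrite phiN// phiE// => jde; have /andP[] := notN e ez Ne.
    by rewrite -jde leNgt jo.
  + rewrite phiE// phiN// => jde; have /andP[] := notN d dz Nd.
    by rewrite jde leNgt jo.
  + by rewrite !phiE.
- have [Nd|Nd] := pselect (N d); first by rewrite phiN//; exact: lt_le_trans (jo d Nd) og.
  by rewrite phiE//; have /andP[] := notN d dz Nd.
exists K; split=> //; apply: (@small_sub _ _ ((K `\` N) `|` (K `&` N))).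
  by move=> d Kd; have [Nd|Nd] := pselect (N d); [right|left].
apply: (@small_countableU z) => //.
- by move=> d [[/Kz]|[/Kz]].
- by apply: small_sub sK => d [Kd Nd]; exists d => //; exact: phiE.
- apply: subset_countable (countableU countable_seg_omega cgz); exact: subIsetr.
Qed.

(** Here the indices below b stay and those in [b, z) go into [b, b + omega). If
    the subcover K has infinitely many indices at or above b, some of them must be
    sent below b by a witness f of smallness, for only finitely many values are
    left between b and b + omega; this bounds the part of K below b by an ordinal
    less than b, and the countable rest is absorbed. *)
Lemma compact_absorb_omega b z (O : Ord -> set X) : thick b ->
  compact_cc tau (ord_add b omega) (ord_add b omega) -> countable (between b z) ->
  (forall d, d < z -> tau (O d)) -> is_cover (seg z) O ->
  exists K, [/\ K `<=` seg z, small (ord_add b omega) K & is_cover K O].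
Proof.
move=> tb cpt cbz Ot Oc.
have [j [jinj jo]] : exists j : Ord -> Ord, {in between b z &, injective j} /\
    forall d, between b z d -> between b (ord_add b omega) (j d).
  apply: card_le_inj; apply: card_le_trans cbz _.
  exact/infiniteP/infinite_between_omega.
pose phi d := if d < b then d else j d.
have phib d : d < b -> phi d = d by rewrite /phi => ->.
have phij d : b <= d -> phi d = j d by rewrite /phi leNgt => /negbTE->.
have jge d : b <= d -> d < z -> b <= j d.
  by move=> bd dz; have /andP[] := jo d (introT andP (conj bd dz)).
have [d e /set_mem dz /set_mem ez|d dz|K [Kz [c [f [cbo fK fc]]] Kc]] :=
  compact_reindex (phi := phi) cpt Ot Oc.
- have [db|bd] := ltP d b; have [eb|be] := ltP e b.
  + by rewrite !phib.
  + by rewrite phib// phij// => dj; have := jge e be ez; rewrite -dj leNgt db.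
  + by rewrite phij// phib// => dj; have := jge d bd dz; rewrite dj leNgt eb.
  + by rewrite !phij// => jde; apply: jinj => //; apply/mem_set/andP.
- have [db|bd] := ltP d b; first by rewrite phib// (lt_le_trans db)// ord_add_ge.
  by rewrite phij//; have /andP[] := jo d (introT andP (conj bd dz)).
exists K; split=> //; have [fin|inf] := pselect (finite_set (K `\` seg b)).
  exact: small_finite Kz fin.
have [[k [Kk kb] fkb]|nk] := pselect (exists2 k, (K `\` seg b) k & f (phi k) < b); last first.
  case: inf; apply: (inj_finite (f := f \o phi)) (finite_between cbo).
    move=> x y /set_mem[Kx /negP xb] /set_mem[Ky /negP yb] /= fxy.
    rewrite -!leNgt in xb yb.
    have : phi x = phi y by apply: (strict_on_inj fK) fxy; apply/mem_set; [exists x|exists y].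
    rewrite !phij// => jxy; apply: jinj jxy; apply/mem_set/andP; split=> //; exact: Kz.
  move=> x KN; have [Kx xb] := KN; apply/andP; split; last by apply: fc; exists x.
  by rewrite leNgt; apply/negP => h; apply: nk; exists x.
apply: small_leW (ord_add_ge b omega) _.
move/negP: kb; rewrite -leNgt => bk.
apply: (@small_sub _ _ ((K `&` seg b) `|` between b z)).
  by move=> d Kd; have [db|bd] := ltP d b; [left|right; apply/andP; split=> //; exact: Kz].
have [bz|zb] := leP b z; last first.
  by have := lt_trans (Kz _ Kk) zb; rewrite ltNge bk.
apply: (@small_countableU z) => //.
- by move=> d [[/Kz]|/andP[]].
- exists (f (phi k)), f; split=> // [x y [Kx xb] [Ky yb] xy|d [Kd db]].
    by apply: fK => //; [exists x|exists y] => //; rewrite phib.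
  apply: fK; [by exists d => //; rewrite phib|by exists k|].
  by rewrite phij//; apply: lt_le_trans db _; apply: jge => //; exact: Kz.
Qed.

(** Induction on the length z. As long as [star beta] is not countably close to z,
    [star z] lies between beta and alpha and covers shrink to a type below it. *)
Lemma compact_descend alpha beta : omega <= beta ->
  compact_cc tau (star2 beta) (star2 beta) ->
  (forall g, beta <= g -> g <= alpha -> g = star g -> compact_cc tau g g) ->
  compact_co tau (star2 beta) (ord_add alpha omega1).
Proof.
move=> ob cpt2 cptg z _ za; apply/compact_ccP.
have tb := @star_thick beta; have cb := @star_countable beta.
elim/ord_ind: z za => z IH za O Ot Oc.
have [cz|ncz] := pselect (countable (between (star beta) z)).
  have [[E b0 _]|[E cfb _]|[E _]] := star2_cases ob; rewrite E in cpt2 *.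
  - exact: compact_absorb.
  - by apply: compact_absorb => //; have [] := cf_omega_seq cfb.
  - exact: compact_absorb_omega.
pose g := star z; have tg : thick g := @star_thick z.
have bg : beta <= g.
  rewrite leNgt; apply/negP => gb; apply: ncz.
  apply: subset_countable (@between_cat _ g _) _; apply: countableU (star_countable z).
  by apply: subset_countable cb; apply/between_subr/ltW.
have ga : g <= alpha.
  rewrite leNgt; apply/negP => ag; have gz : g <= z := star_le z.
  have : g <= alpha by apply: star_min; [exact: le_trans (ltW ag) gz|exact: countable_between].
  by rewrite leNgt ag.
have g0 : ozero < g.
  exact: lt_le_trans omega_gt0 (le_trans ob bg).
have [K [Kz /smallP[c cg /has_otypeE[f [fS fK]]] Kc]] :=
  compact_absorb tg g0 (cptg g bg ga (esym (thick_star tg))) (star_countable z) Ot Oc.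
have cz : c < z := lt_le_trans cg (star_le z).
have fz d : d < c -> f d < z by move=> dc; apply: Kz; rewrite -fK; exists d.
have [||H [Hc sH Hcov]] := IH c cz (lt_trans cz za) (O \o f).
- by move=> d dc; apply: Ot; exact: fz.
- apply/is_coverP => x; move/is_coverP: Kc => /(_ x)[d]; rewrite -fK => -[e ec <-] Ox.
  by exists e.
exists (f @` H); split.
- by move=> _ [d /Hc dc <-]; exact: fz.
- by apply: small_image sH; exact: strict_on_sub fS.
- apply/is_coverP => x; move/is_coverP: Hcov => /(_ x)[d Hd Ox].
  by exists (f d) => //; exists d.
Qed.

End Compact.

Local Open Scope classical_set_scope.
Local Open Scope order_scope.

Theorem corollary6p10 (X : Type) (tau : set (set X)) (alpha beta : Ord)
    (X_nonempty : [set: X] !=set0) (tau_nonempty : tau !=set0)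
    (tau_T1 : T1_family tau)
    (beta_infinite : omega <= beta) (beta_le_alpha : beta <= alpha) :
  [<-> compact_cc tau beta alpha;
       compact_co tau (star2 beta) (alpha + omega1)%Ord;
       compact_cc tau (star2 beta) (star2 beta) /\
         (forall gamma : Ord, beta <= gamma -> gamma <= alpha ->
            gamma = star gamma -> compact_cc tau gamma gamma)].
Proof.
have s2b := star2_le beta_infinite; have s20 := star2_gt0 beta_infinite.
have alt : alpha < ord_add alpha omega1.
  exact: le_lt_trans (ord_add_ge alpha ozero) (ord_add_ltl _ omega1_gt0).
tfae.
- move=> cpt; apply: compact_descend => //.
    by apply: compact_star2 => //; exact: compact_mono cpt.
  by move=> g bg ga _; apply: compact_mono bg ga cpt.
- move=> cpt; split.
    by apply: cpt => //; exact: le_lt_trans (le_trans s2b beta_le_alpha) alt.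
  move=> g bg ga _; have s2g := le_trans s2b bg.
  apply: (compact_mono _ s2g (lexx g)) => //.
  by apply: cpt; [exact: lt_le_trans s2g|exact: le_lt_trans alt].
- move=> [cpt2 cptg].
  apply: (compact_mono X_nonempty s2b (lexx alpha)).
  apply: (compact_descend X_nonempty (alpha := alpha)) => //.
  exact: lt_le_trans s20 (le_trans s2b beta_le_alpha).
Qed.
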